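(* For every $K\ge 1$ there are instances of the non-clairvoyant bag-of-tasks scheduling problem on related machines with $K$ distinct machine speeds for which every online non-clairvoyant algorithm has competitive ratio $\Omega(K)$. That is, there is an absolute constant $c>0$ such that no online non-clairvoyant algorithm has competitive ratio smaller than $cK$ on all instances with $K$ distinct speeds.
   Context: Bag-of-tasks scheduling on related machines: there are $m$ machines, machine $i$ having speed $s_i>0$; $K$ denotes the number of distinct values among the speeds. Each job $j$ has a weight $w_j\ge 0$ and consists of a finite set $T(j)$ of tasks; each task $v$ has a processing requirement $p_v\ge 0$. A task can be preempted and migrated; a task runs on at most one machine at any time, while different tasks (of the same or different jobs) may run simultaneously on different machines, and a machine of speed $s$ running a task for $\varepsilon$ time units does $s\varepsilon$ units of processing on it. A task finishes when it has received $p_v$ units of processing; a job completes (at time $C_j$) when all its tasks have finished. The objective is to minimize $\sum_j w_j C_j$. In the online non-clairvoyant setting the algorithm knows the jobs, their weights and their tasks, but learns the processing requirement of a task only when that task finishes. The competitive ratio of an algorithm is the supremum over instances of the ratio between its objective value and that of an optimal offline (clairvoyant) schedule on the same machines. *)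

(* Defs.v *)
From HB Require Import structures.
From mathcomp Require Import all_boot all_order all_algebra.
From mathcomp Require Import all_classical all_reals all_analysis.

Set Implicit Arguments.
Unset Strict Implicit.
Unset Printing Implicit Defensive.

Import Order.TTheory GRing.Theory Num.Theory.

Local Open Scope classical_set_scope.
Local Open Scope ring_scope.

(* The part of an instance that is known to an online algorithm from the start.
   The bag T(j) is the fibre of job_of over j. *)
Record environment (R : realType) := Environment {
  nmach : nat;
  njob : nat;
  ntask : nat;
  speed : 'I_nmach -> R;
  weight : 'I_njob -> R;
  job_of : 'I_ntask -> 'I_njob;
  speed_gt0 : forall i, 0 < speed i;
  weight_ge0 : forall j, 0 <= weight j }.

Definition nspeeds (R : realType) (E : environment R) : nat :=
  size (undup (codom (@speed R E))).

Definition requirements (R : realType) (E : environment R) :=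
  'I_(ntask E) -> R.

Definition valid_requirements (R : realType) (E : environment R)
  (p : requirements E) : Prop := forall v, 0 <= p v.

(* sigma t i is the task run by machine i at time t, None if it is idle; only
   the times t >= 0 matter. *)
Definition schedule (R : realType) (E : environment R) :=
  R -> 'I_(nmach E) -> option 'I_(ntask E).

Definition running (R : realType) (E : environment R) (sigma : schedule E)
  (i : 'I_(nmach E)) (v : 'I_(ntask E)) (t : R) : set R :=
  [set u | 0 <= u <= t /\ sigma u i = Some v].

(* Measurability is what makes the amount of processing meaningful; arbitrary
   preemption and migration are allowed. *)
Definition feasible (R : realType) (E : environment R)
  (sigma : schedule E) : Prop :=
  (forall i v t, measurable (running sigma i v t)) /\
  (forall t i i' v, 0 <= t ->
     sigma t i = Some v -> sigma t i' = Some v -> i = i').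

Definition processing (R : realType) (E : environment R) (sigma : schedule E)
  (v : 'I_(ntask E)) (t : R) : \bar R :=
  (\sum_(i < nmach E)
     (speed i)%:E * (@lebesgue_measure R) (running sigma i v t))%E.

(* +oo if the task never receives its full requirement, 0 if p v = 0. *)
Definition finish_time (R : realType) (E : environment R)
  (p : requirements E) (sigma : schedule E) (v : 'I_(ntask E)) : \bar R :=
  ereal_inf [set t%:E | t in
    [set t : R | 0 <= t /\ ((p v)%:E <= processing sigma v t)%E]].

Definition completion_time (R : realType) (E : environment R)
  (p : requirements E) (sigma : schedule E) (j : 'I_(njob E)) : \bar R :=
  \big[maxe/0%E]_(v < ntask E | job_of v == j) finish_time p sigma v.

Definition cost (R : realType) (E : environment R)
  (p : requirements E) (sigma : schedule E) : \bar R :=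
  (\sum_(j < njob E) (weight j)%:E * completion_time p sigma j)%E.

Definition opt (R : realType) (E : environment R) (p : requirements E) : \bar R :=
  ereal_inf [set cost p sigma | sigma in [set sigma | @feasible R E sigma]].

(* What an observer of the two runs learns up to time t: which tasks have
   finished, when, and with which requirement. *)
Definition same_history (R : realType) (E : environment R)
  (p p' : requirements E) (sigma sigma' : schedule E) (t : R) : Prop :=
  forall v, (finish_time p sigma v <= t%:E)%E \/
            (finish_time p' sigma' v <= t%:E)%E ->
    finish_time p sigma v = finish_time p' sigma' v /\ p v = p' v.

Definition algorithm (R : realType) :=
  forall E : environment R, requirements E -> schedule E.

(* A deterministic algorithm is given by the schedule it produces on every
   instance.  Its own past decisions are deliberately not part of the history:
   they are determined by the observations, and comparing them would allow
   two runs to diverge immediately after time 0 without any new observation. *)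
Definition online_nonclairvoyant (R : realType) (A : algorithm R) : Prop :=
  (forall (E : environment R) (p : requirements E),
     valid_requirements p -> feasible (A E p)) /\
  (forall (E : environment R) (p p' : requirements E) (t : R),
     valid_requirements p -> valid_requirements p' -> 0 <= t ->
     same_history p p' (A E p) (A E p') t ->
     A E p t = A E p' t).

(* Instances of optimal value 0 are left out: there every requirement of a task
   of a job of positive weight is 0, so every schedule has cost 0. *)
Definition competitive_ratio (R : realType) (A : algorithm R) (K : nat) : \bar R :=
  ereal_sup [set r | exists (E : environment R) (p : requirements E),
    [/\ nspeeds E = K, valid_requirements p, (0 < opt p)%E &
        r = (cost p (A E p) / opt p)%E]].

(* Main.v *)
(* One job, 4^(K-k) machines of speed 2^k for each k < K, and as many tasks as
   machines; the requirement of task v is the speed of machine s v for a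
   permutation s, so that the optimum is at most 1 whatever s is.  Up to time
   k/8 the algorithm should not know which tasks are of class at least k: the
   adversary wants s such that no task of class above k has received 2^k units
   by the deadline (k+1)/8.  If some task violates this, then at the first
   violation some task of class k is still unfinished, because in time 1/8 the
   machines of speed at least 2^k are too few and the others too slow;
   exchanging the two tasks is invisible to the algorithm up to that moment.
   Hence a permutation maximizing the time of the first violation, and then
   minimizing the number of violations at that time, has none.  For it, some
   task of class K-1 is unfinished at time K/8. *)
Require Import Defs.
From mathcomp Require Import all_boot all_order all_fingroup all_algebra.
From mathcomp Require Import all_classical all_reals all_analysis.
From mathcomp Require Import ring lra.

Set Implicit Arguments.
Unset Strict Implicit.
Unset Printing Implicit Defensive.

Import Order.TTheory GRing.Theory Num.Theory.

Local Open Scope classical_set_scope.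
Local Open Scope ring_scope.

(** * Processing received by a task as a function of time *)

(** Serves two capacity bounds: over the tasks on one machine, which runs one task at a time, and
    over the machines for one task, which never runs on two at once. *)
Lemma sum_measure_disjoint_le (R : realType) n (F : 'I_n -> set R) (e t : R) :
  e <= t -> (forall j, measurable (F j)) ->
  (forall j j' x, F j x -> F j' x -> j = j') ->
  (forall j, F j `<=` `]e, t]) ->
  (\sum_(j < n) lebesgue_measure (F j) <= (t - e)%:E)%E.
Proof.
move=> et mF dF sF; rewrite -measure_bigsetU_ord //; last first.
  by move=> j j' _ _ [x [Fx F'x]]; exact: dF Fx F'x.
apply: (@le_trans _ _ (lebesgue_measure `]e, t]%classic)).
  apply: le_measure; rewrite ?inE //=.
    by apply: bigsetU_measurable => j _; exact: mF.
  by elim/big_ind: _ => // A B sA sB x [/sA|/sB].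
rewrite lebesgue_measure_itv /= lte_fin.
by case: ifP => // _; rewrite lee_fin subr_ge0.
Qed.

Section Processing.
Variables (R : realType) (E : environment R) (sigma : schedule E).
Hypothesis feas : feasible sigma.
Implicit Types (i : 'I_(nmach E)) (v : 'I_(ntask E)) (e t u : R).

Definition run_time i v t : R := fine (lebesgue_measure (running sigma i v t)).

Definition work v t : R := \sum_(i < nmach E) speed i * run_time i v t.

Lemma measurable_running i v t : measurable (running sigma i v t).
Proof. by case: feas => + _; exact. Qed.

Lemma run_timeE i v t :
  lebesgue_measure (running sigma i v t) = (run_time i v t)%:E.
Proof.
rewrite fineK // ge0_fin_numE ?measure_ge0 //.
apply: (@le_lt_trans _ _ (lebesgue_measure `[0, t]%classic)).
  apply: le_measure; rewrite ?inE //; first exact: measurable_running.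
  by move=> x [/= x0t _]; rewrite in_itv.
by rewrite lebesgue_measure_itv /=; case: ifP => _; rewrite ltey.
Qed.

Lemma processingE v t : processing sigma v t = (work v t)%:E.
Proof.
by rewrite /processing -sumEFin; apply: eq_bigr => i _; rewrite run_timeE.
Qed.

Definition running_between i v e t :=
  running sigma i v t `\` running sigma i v e.

Lemma running_between_itv i v e t x :
  running_between i v e t x -> [/\ e < x <= t, 0 <= x & sigma x i = Some v].
Proof.
move=> [[/andP[x0 xt] sx] nx]; split=> //; rewrite xt andbT ltNge.
by apply/negP => xe; apply: nx; split; rewrite ?x0.
Qed.

Lemma measurable_running_between i v e t : measurable (running_between i v e t).
Proof. by apply: measurableD; exact: measurable_running. Qed.

Lemma measure_running_between i v e t : e <= t ->
  lebesgue_measure (running_between i v e t) =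
  (run_time i v t - run_time i v e)%:E.
Proof.
move=> et; have sub : running sigma i v e `<=` running sigma i v t.
  by move=> x [/andP[x0 xe] sx]; split; rewrite // x0 (le_trans xe).
pose mu := @lebesgue_measure R; rewrite -/mu.
have -> : mu (running_between i v e t) = (mu (running sigma i v t) -
    mu (running sigma i v t `&` running sigma i v e))%E.
  apply: measureD; try exact: measurable_running.
  by change (mu (running sigma i v t) < +oo)%E; rewrite /mu run_timeE ltey.
by rewrite (setIidr sub) /mu !run_timeE EFinB.
Qed.

Lemma run_time_le i v e t : e <= t -> run_time i v e <= run_time i v t.
Proof.
by move=> et; rewrite -subr_ge0 -lee_fin -measure_running_between.
Qed.

Lemma sum_task_run_time_le i e t : e <= t ->
  \sum_(v < ntask E) (run_time i v t - run_time i v e) <= t - e.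
Proof.
move=> et; rewrite -lee_fin -sumEFin.
under eq_bigr do rewrite -measure_running_between//.
apply: sum_measure_disjoint_le => //.
- by move=> v; exact: measurable_running_between.
- move=> v v' x /running_between_itv[_ _ sx] /running_between_itv[_ _].
  by rewrite sx => -[].
- by move=> v x /running_between_itv[exb _ _]; rewrite /= in_itv.
Qed.

Lemma sum_machine_run_time_le v e t : e <= t ->
  \sum_(i < nmach E) (run_time i v t - run_time i v e) <= t - e.
Proof.
move=> et; rewrite -lee_fin -sumEFin.
under eq_bigr do rewrite -measure_running_between//.
apply: sum_measure_disjoint_le => //.
- by move=> i; exact: measurable_running_between.
- move=> i i' x /running_between_itv[_ x0 sx] /running_between_itv[_ _ sx'].
  by case: feas => _; apply; eauto.
- by move=> i x /running_between_itv[exb _ _]; rewrite /= in_itv.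
Qed.

Definition max_rate : R := \sum_(i < nmach E) speed i.

Lemma max_rate_ge0 : 0 <= max_rate.
Proof. by apply: sumr_ge0 => i _; exact: ltW (speed_gt0 i). Qed.

Lemma work_le v e t : e <= t -> work v e <= work v t.
Proof.
move=> et; apply: ler_sum => i _.
by rewrite ler_wpM2l ?(ltW (speed_gt0 i)) // run_time_le.
Qed.

(** This continuity in time is what lets infima of times be attained and agreement on [[0, t)] be
    extended to time [t]. *)
Lemma work_lipschitz v e t : e <= t ->
  work v t <= work v e + max_rate * (t - e).
Proof.
move=> et; rewrite -lerBlDl -sumrB /max_rate mulr_suml; apply: ler_sum => i _.
rewrite -mulrBr ler_wpM2l ?(ltW (speed_gt0 i)) //.
apply: le_trans (sum_task_run_time_le i et); rewrite (bigD1 v) //= lerDl.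
by apply: sumr_ge0 => w _; rewrite subr_ge0 run_time_le.
Qed.

Lemma work0 v : work v 0 = 0.
Proof.
rewrite /work big1 // => i _; rewrite /run_time.
have -> : lebesgue_measure (running sigma i v 0) = 0%E.
  apply/eqP; rewrite eq_le measure_ge0 andbT.
  apply: (@le_trans _ _ (lebesgue_measure `[0, 0]%classic)).
    apply: le_measure; rewrite ?inE //; first exact: measurable_running.
    by move=> x [/= x0 _]; rewrite in_itv.
  by rewrite lebesgue_measure_itv /= ltxx.
by rewrite mulr0.
Qed.

(** The infimum is attained: the requirement is met at every [u > t], and [work] is Lipschitz, hence
    it is met at [t]. *)
Lemma finish_time_leP (p : requirements E) v t : 0 <= t ->
  (finish_time p sigma v <= t%:E)%E <-> p v <= work v t.
Proof.
move=> t0; split=> [ft|pw]; last first.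
  by apply: ereal_inf_lbound; exists t => //; split=> //;
    rewrite processingE lee_fin.
have pw u : t < u -> p v <= work v u.
  move=> tu; have /ereal_inf_lt[_ [u' [u'0 +] <-]] :
      (finish_time p sigma v < u%:E)%E.
    by apply: le_lt_trans ft _; rewrite lte_fin.
  rewrite processingE lee_fin lte_fin => pu' u'u.
  by apply: le_trans pu' _; apply/work_le/ltW.
apply/ler_addgt0Pr => eps eps0; have S0 := max_rate_ge0.
(* At most [max_rate * d <= eps] is processed in time [d]; adding 1 keeps the denominator positive
   even without machines. *)
pose d := eps / (max_rate + 1).
have S1 : 0 < max_rate + 1 by lra.
have d0 : 0 < d by rewrite divr_gt0.
have /pw/le_trans : t < t + d by lra.
apply; apply: le_trans (work_lipschitz v (_ : t <= t + d)) _; first by lra.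
rewrite lerD2l addrC addKr mulrC /d mulrAC ler_pdivrMr //.
by rewrite ler_wpM2l // ?ltW //; lra.
Qed.

Lemma finish_time_ge0 (p : requirements E) v : (0 <= finish_time p sigma v)%E.
Proof. by apply: le_ereal_inf_tmp => _ [t [t0 _] <-]; rewrite lee_fin. Qed.

End Processing.

(** * Runs that an online algorithm cannot tell apart *)

(** The schedules may differ at [t] itself, so the amounts are compared at [t - d], where they
    coincide, and the Lipschitz bound covers the last [d] time units. *)
Lemma work_le_of_eq (R : realType) (E : environment R)
    (sigma sigma' : schedule E) t :
  feasible sigma -> feasible sigma' ->
  (forall u, 0 <= u < t -> sigma u = sigma' u) ->
  forall v, work sigma v t <= work sigma' v t.
Proof.
move=> fs fs' eqs v; apply/ler_addgt0Pr => eps eps0.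
have S0 := @max_rate_ge0 R E.
have S1 : 0 < @max_rate R E + 1 by lra.
pose d := eps / (@max_rate R E + 1).
have d0 : 0 < d by rewrite divr_gt0.
have td : t - d <= t by lra.
have eq_at u : 0 <= u <= t - d -> sigma u = sigma' u.
  by move=> /andP[u0 ud]; apply: eqs; rewrite u0 /=; lra.
have eqr i : running sigma i v (t - d) = running sigma' i v (t - d).
  by apply/seteqP; split=> u [ub us]; split=> //; move: us; rewrite eq_at.
have eqw : work sigma v (t - d) = work sigma' v (t - d).
  by apply: eq_bigr => i _; rewrite /run_time eqr.
apply: le_trans (work_lipschitz fs v td) _; rewrite eqw.
apply: lerD; first exact: work_le.
rewrite opprB addrC subrK mulrC /d mulrAC ler_pdivrMr //.
by rewrite ler_wpM2l // ?ltW //; lra.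
Qed.

Lemma eq_work (R : realType) (E : environment R) (sigma sigma' : schedule E) t :
  feasible sigma -> feasible sigma' ->
  (forall u, 0 <= u < t -> sigma u = sigma' u) ->
  forall v, work sigma v t = work sigma' v t.
Proof.
move=> fs fs' eqs v; apply/eqP.
by rewrite eq_le !work_le_of_eq // => u ut; rewrite eqs.
Qed.

(* Look at the first finishing event in which the two runs differ, at time m say:
   before m the observations, hence the schedules, are the same, so at m every
   task has received the same amount of processing in both. *)
Lemma online_agree (R : realType) (A : algorithm R) (E : environment R)
    (p p' : requirements E) (T : R) :
  online_nonclairvoyant A -> valid_requirements p -> valid_requirements p' ->
  (forall v, p v != p' v -> forall t, 0 <= t < T ->
     work (A E p) v t < p v /\ work (A E p) v t < p' v) ->
  forall t, 0 <= t < T -> A E p t = A E p' t.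
Proof.
move=> [feas onl] vp vp' small.
have fs := feas E p vp; have fs' := feas E p' vp'.
pose f := finish_time p (A E p); pose f' := finish_time p' (A E p').
pose m v := mine (f v) (f' v).
have mP v t : (m v <= t%:E)%E <-> (f v <= t%:E)%E \/ (f' v <= t%:E)%E.
  by rewrite /m ge_min; split=> /orP.
pose D v := (m v < T%:E)%E && ~~ ((f v == f' v) && (p v == p' v)).
have agree_until (u : \bar R) : (forall v, D v -> (u <= m v)%E) ->
    forall t, 0 <= t < T -> (t%:E < u)%E -> A E p t = A E p' t.
  move=> uD t /andP[t0 tT] tu; apply: onl => // v /mP mv.
  have [/uD um|] := boolP (D v).
    by have := le_lt_trans um (le_lt_trans mv tu); rewrite ltxx.
  rewrite /D negb_and negbK (le_lt_trans mv) ?lte_fin //=.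
  by move=> /andP[/eqP ? /eqP].
case: (pickP D) => [v0 Dv0|D0]; last first.
  move=> t /andP[t0 tT]; apply: (agree_until T%:E) => //; last by rewrite t0.
  by move=> v; rewrite D0.
case: (@Order.TotalTheory.arg_minP _ _ _ v0 D m Dv0) => v Dv vmin.
have := Dv; rewrite /D => /andP[mT nv].
have m0 : (0 <= m v)%E by rewrite le_min !finish_time_ge0.
have [r mr] : exists r, m v = r%:E.
  by move: m0 mT; case: (m v) => // r _ _; exists r.
move: m0 mT; rewrite mr lee_fin lte_fin => r0 rT.
have eqw : forall w, work (A E p) w r = work (A E p') w r.
  apply: eq_work => // u /andP[u0 ur]; apply: (agree_until r%:E) => //.
  - by move=> w Dw; rewrite -mr vmin.
  - by rewrite u0 (lt_trans ur).
have ffr : (f v <= r%:E)%E \/ (f' v <= r%:E)%E by apply/mP; rewrite mr.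
(* Distinct requirements are excluded because [v] is unfinished in both runs at [r < T]. Equal ones,
   with equal work at [r], make [v] finish exactly at [r] in both runs, so [v] is not in [D]. *)
have [epp|npp] := eqVneq (p v) (p' v); last first.
  have [|wp wp'] := small v npp r; first by rewrite r0.
  case: ffr => [/(finish_time_leP fs _ _ r0)|/(finish_time_leP fs' _ _ r0)].
    by rewrite leNgt wp.
  by rewrite -eqw leNgt wp'.
have both : (f v <= r%:E)%E /\ (f' v <= r%:E)%E.
  rewrite !finish_time_leP // -eqw epp.
  case: ffr => [/(finish_time_leP fs _ _ r0)|/(finish_time_leP fs' _ _ r0)].
    by rewrite epp.
  by rewrite -eqw.
case: both => fr fr'; move: nv; rewrite epp eqxx andbT.
have: (r%:E <= f v)%E by rewrite -mr ge_min lexx.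
have: (r%:E <= f' v)%E by rewrite -mr ge_min lexx orbT.
move=> rf' rf; have -> : f v = r%:E by apply/le_anti; rewrite fr rf.
have -> : f' v = r%:E by apply/le_anti; rewrite fr' rf'.
by rewrite eqxx.
Qed.


(** * The hard instance and its capacity bounds *)

(** The index set is an enumeration of the disjoint union of the ['I_(N k)], and the class is the
    tag. *)
Lemma exists_class_map (K : nat) (N : nat -> nat) :
  exists n (cls : 'I_n -> 'I_K),
    forall k : 'I_K, #|[pred i | cls i == k]| = N k.
Proof.
pose T := {k : 'I_K & 'I_(N k)}.
exists #|{: T}|, (fun i => tag (enum_val i)) => k.
rewrite -sum1_card (reindex_onto enum_rank enum_val) /=; last first.
  by move=> i _; rewrite enum_valK.
under eq_bigl do rewrite inE /= enum_rankK eqxx andbT.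
transitivity (\sum_(l | l == k) \sum_(j < N l | true) 1)%N.
  by rewrite sig_big_dep /=; apply: eq_bigl => x; rewrite andbT.
by rewrite big_pred1_eq sum1_card card_ord.
Qed.

Section HardInstance.
Variables (R : realType) (K n : nat) (cls : 'I_n -> 'I_K).
Hypothesis card_cls :
  forall k : 'I_K, #|[pred i | cls i == k]| = (4 ^ (K - k))%N.

Let exp2_gt0 (i : 'I_n) : 0 < 2 ^+ cls i :> R.
Proof. by rewrite exprn_gt0. Qed.

Let one_ge0 (j : 'I_1) : 0 <= 1 :> R.
Proof. exact: ler01. Qed.

Definition hard_env : environment R :=
  @Environment R n 1 n _ _ (fun=> ord0) exp2_gt0 one_ge0.

Definition hard_req (s : {perm 'I_n}) : requirements hard_env :=
  fun v => 2 ^+ cls (s v).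

Lemma valid_hard_req s : valid_requirements (hard_req s).
Proof. by move=> v; rewrite exprn_ge0. Qed.

(** The total speed [a l] of class [l] halves from each class to the next, so the geometric sum
    telescopes through [a l = 2 * a l - 2 * a l.+1]. *)
Lemma fast_speed_le (k : nat) : (k <= K)%N ->
  \sum_(i < n | (k <= cls i)%N) 2 ^+ cls i <= 2 * (4 ^+ (K - k) * 2 ^+ k) :> R.
Proof.
move=> kK; pose a l : R := 4 ^+ (K - l) * 2 ^+ l.
have -> : \sum_(i < n | (k <= cls i)%N) 2 ^+ cls i = \sum_(k <= l < K) a l.
  rewrite big_geq_mkord /=.
  rewrite (partition_big cls (fun l : 'I_K => (k <= l)%N)) //=.
  apply: eq_bigr => l kl; transitivity (\sum_(i < n | cls i == l) 2 ^+ l : R).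
    apply: eq_big => [i|i /andP[_ /eqP->] //].
    by case: eqP => [->|]; rewrite ?andbF ?kl.
  by rewrite sumr_const card_cls -[LHS]mulr_natl natrX.
rewrite (@telescope_sumr_eq _ _ _ (fun l => - (2 * a l))) //.
  by rewrite opprK addrC lerBlDr lerDl !mulr_ge0 ?exprn_ge0.
move=> l /andP[kl lK]; rewrite /a -(subnSK lK) !exprS; ring.
Qed.

Variable sigma : schedule hard_env.
Hypothesis feas : feasible sigma.

(* In time 1/8 the slower machines give each task of U at most 2^k / 16, so the
   faster ones give it at least 7/16 2^k, out of a total of at most
   1/8 * 2 * 4^(K-k) 2^k (fast_speed_le). *)
Lemma card_advanced_lt (U : {set 'I_n}) (k : 'I_K) (e t : R) :
  e <= t <= e + 8^-1 ->
  (forall u, u \in U -> work sigma u e <= 2 ^+ k / 2) ->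
  (forall u, u \in U -> 2 ^+ k <= work sigma u t) ->
  (#|U| < 4 ^ (K - k))%N.
Proof.
move=> /andP[et te] We Wt.
pose D (u i : 'I_n) : R :=
  run_time sigma i u t - run_time sigma i u e.
have D0 u i : 0 <= D u i by rewrite subr_ge0 run_time_le.
have k0 : 0 < 2 ^+ k :> R by rewrite exprn_gt0.
pose F u : R := \sum_(i < n | (k <= cls i)%N) 2 ^+ cls i * D u i.
have FU u : u \in U -> 2 ^+ k * (7 / 16) <= F u.
  move=> uU; have : work sigma u t - work sigma u e <= 2 ^+ k / 2 * 8^-1 + F u.
    rewrite -sumrB (bigID (fun i : 'I_n => (k <= cls i)%N)) /= addrC.
    apply: lerD; last by apply: ler_sum => i _; rewrite -mulrBr.
    apply: (@le_trans _ _ (\sum_(i < n) 2 ^+ k / 2 * D u i)); last first.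
      rewrite -mulr_sumr ler_wpM2l ?divr_ge0 ?(ltW k0) //.
      apply: (@le_trans _ _ (t - e)); last lra.
      exact: (sum_machine_run_time_le feas u et).
    rewrite [leRHS](bigID (fun i : 'I_n => (k <= cls i)%N)) /=.
    apply: ler_wpDl.
      by apply: sumr_ge0 => i _; rewrite mulr_ge0 ?divr_ge0 ?(ltW k0).
    apply: ler_sum => i; rewrite -ltnNge => ik.
    rewrite -mulrBr; apply: ler_wpM2r; first exact: (D0 u i).
    rewrite /= ler_pdivlMr // -exprSr.
    by rewrite ler_weXn2l ?ler1n.
  by have := We u uU; have := Wt u uU; lra.
have sumF : \sum_(u in U) F u <= 4 ^+ (K - k) * 2 ^+ k / 4.
  rewrite exchange_big /=.
  apply: (@le_trans _ _ (\sum_(i < n | (k <= cls i)%N) 2 ^+ cls i * 8^-1)).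
    apply: ler_sum => i _; rewrite -mulr_sumr ler_wpM2l ?exprn_ge0 //.
    apply: (@le_trans _ _ (\sum_(u < n) D u i)).
      by rewrite [leRHS](bigID (mem U)) /= lerDl sumr_ge0.
    apply: (@le_trans _ _ (t - e)); last lra.
      exact: (sum_task_run_time_le feas i et).
  rewrite -mulr_suml; have := fast_speed_le (ltnW (ltn_ord k)); lra.
have : #|U|%:R * (2 ^+ k * (7 / 16)) <= \sum_(u in U) F u.
  by rewrite mulr_natl -sumr_const; apply: ler_sum => u uU; exact: FU.
move=> /le_trans/(_ sumF) main.
rewrite -(ltr_nat R) natrX.
have N0 : 0 < 4 ^+ (K - k) :> R by rewrite exprn_gt0.
(* Hence [#|U|] is at most 4/7 of the positive number [4 ^+ (K - k)]. *)
have : #|U|%:R * (7 / 16) <= 4 ^+ (K - k) / 4 :> R.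
  by rewrite -(ler_pM2r k0); lra.
lra.
Qed.

End HardInstance.

Arguments hard_req R {K n} cls s _.


(** * The offline optimum of the hard instance *)

Lemma hard_cost (R : realType) K n (cls : 'I_n -> 'I_K) s
    (sigma : schedule (hard_env R cls)) :
  cost (hard_req R cls s) sigma =
  \big[maxe/0%E]_(v < n) finish_time (hard_req R cls s) sigma v.
Proof.
rewrite /cost /= big_ord_recl big_ord0 adde0 mul1e.
by apply: eq_bigl => v; rewrite ord1 eqxx.
Qed.

(** Knowing [s], run task [v] on machine [s v] all the time: its requirement equals that speed, so
    it finishes at time 1. *)
Lemma opt_hard_le1 (R : realType) K n (cls : 'I_n -> 'I_K) s :
  (opt (hard_req R cls s) <= 1)%E.
Proof.
pose sigma : schedule (hard_env R cls) := fun _ i => Some ((s^-1)%g i).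
have feas : feasible sigma.
  split=> [i v t|t i i' v _ [<-] [/perm_inj->//]].
  have [<-|ne] := eqVneq ((s^-1)%g i) v; last first.
    rewrite (_ : running _ _ _ _ = set0) //.
    by apply/seteqP; split=> // x [_ [/eqP]]; rewrite (negPf ne).
  rewrite (_ : running _ _ _ _ = `[0, t]%classic).
    exact: measurable_itv.
  apply/seteqP; split=> x /=; rewrite in_itv /=; first by case.
  by move=> x0t; split.
apply: ge_ereal_inf; exists (cost (hard_req R cls s) sigma).
  by exists sigma.
rewrite hard_cost; apply/bigmax_leP; split=> // v _.
apply/(finish_time_leP feas _ _ ler01).
rewrite /work (bigD1 (s v)) //= /hard_req.
have -> : run_time sigma (s v) v 1 = 1.
  rewrite /run_time (_ : running _ _ _ _ = `[0, 1]%classic).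
    by rewrite lebesgue_measure_itv /= lte_fin ltr01 -EFinB subr0.
  apply/seteqP; split=> x /=; rewrite in_itv /=; first by case.
  move=> x01; split=> //.
  by rewrite /sigma permK.
rewrite mulr1 lerDl sumr_ge0 // => i _; rewrite mulr_ge0 ?exprn_ge0 //.
by rewrite /run_time fine_ge0.
Qed.

(** Every requirement is at least 1 and no task is processed faster than [max_rate]. Positivity
    admits the instance to [competitive_ratio]. *)
Lemma opt_hard_gt0 (R : realType) K n (cls : 'I_n -> 'I_K) s : (0 < n)%N ->
  (0 < opt (hard_req R cls s))%E.
Proof.
move=> n0; pose S := max_rate (hard_env R cls) + 1.
have S0 : 0 < S by rewrite ltr_wpDl // max_rate_ge0.
apply: (@lt_le_trans _ _ (S^-1)%:E); first by rewrite lte_fin invr_gt0.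
apply: le_ereal_inf_tmp => _ [sigma feas <-]; rewrite hard_cost.
pose v := Ordinal n0.
apply: (@le_trans _ _ (finish_time (hard_req R cls s) sigma v)); last first.
  by rewrite (bigD1 v) //= le_max lexx.
apply: le_ereal_inf_tmp => _ [t [t0 pt] <-]; rewrite lee_fin.
move: pt; rewrite processingE // lee_fin => pt.
rewrite -[S^-1]mul1r ler_pdivrMr //.
have p1 : 1 <= hard_req R cls s v by rewrite exprn_ege1 // ler1n.
apply: le_trans p1 (le_trans pt _).
have := work_lipschitz feas v t0.
rewrite work0 // add0r subr0 => /le_trans; apply.
by rewrite /S mulrDr mulr1 mulrC lerDl.
Qed.


(** * The adversary's choice of the permutation *)

Section Adversary.
Variables (R : realType) (K n : nat) (cls : 'I_n -> 'I_K).
Hypothesis card_cls :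
  forall k : 'I_K, #|[pred i | cls i == k]| = (4 ^ (K - k))%N.
Variable A : algorithm R.
Hypothesis online : online_nonclairvoyant A.
Implicit Types (s : {perm 'I_n}) (v w : 'I_n) (k : 'I_K) (t : R).

Definition run s : schedule (hard_env R cls) :=
  A (hard_req R cls s).

Lemma feasible_run s : feasible (run s).
Proof. by case: online => + _; apply; exact: valid_hard_req. Qed.

(* Time at which the run under s has given 2 ^+ k units to task v, whatever the
   requirement of v. *)
Definition reach s v (k : nat) : \bar R :=
  @finish_time R (hard_env R cls) (fun=> 2 ^+ k) (run s) v.

Lemma reach_leP s v (k : nat) t : 0 <= t ->
  (reach s v k <= t%:E)%E <-> 2 ^+ k <= work (run s) v t.
Proof. by move=> t0; apply: finish_time_leP => //; exact: feasible_run. Qed.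

Definition deadline (k : nat) : R := k.+1%:R / 8.

(* The pairs (task v, class k) that the adversary must avoid: v is of class
   above k but is recognizable as such by the deadline of class k. *)
Definition early s (x : 'I_n * 'I_K) : bool :=
  (x.2 < cls (s x.1))%N && (reach s x.1 x.2 <= (deadline x.2)%:E)%E.

Definition first_early s : \bar R :=
  \big[mine/+oo%E]_(x | early s x) reach s x.1 x.2.

Lemma earlyI s v k t : (k < cls (s v))%N -> 0 <= t <= deadline k ->
  2 ^+ k <= work (run s) v t -> early s (v, k) /\ (reach s v k <= t%:E)%E.
Proof.
move=> kv /andP[t0 td] /(reach_leP _ _ _ t0) rt; split=> //.
by rewrite /early kv (le_trans rt) // lee_fin.
Qed.

Lemma earlyP s v k : early s (v, k) -> exists t,
  [/\ reach s v k = t%:E, 0 <= t <= deadline k, (k < cls (s v))%N &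
      2 ^+ k <= work (run s) v t].
Proof.
move=> /andP[/= kv rd].
have r0 : (0 <= reach s v k)%E by exact: finish_time_ge0.
have [t rt] : exists t, reach s v k = t%:E.
  by move: r0 rd; case: (reach s v k) => // t _ _; exists t.
move: r0 rd; rewrite rt lee_fin => t0; rewrite lee_fin => td; exists t.
by rewrite t0 td; split=> //; apply/(reach_leP _ _ _ t0); rewrite rt.
Qed.

Lemma first_early_le s x : early s x -> (first_early s <= reach s x.1 x.2)%E.
Proof. exact: bigmin_le_cond. Qed.

Lemma work_lt_before_early s v k t :
  (k < cls (s v))%N -> 0 <= t <= deadline k ->
  (t%:E < first_early s)%E -> work (run s) v t < 2 ^+ k.
Proof.
move=> kv td tf; rewrite ltNge; apply/negP => /(earlyI kv td)[es].
apply/negP; rewrite -ltNge; apply: lt_le_trans tf _.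
exact: first_early_le es.
Qed.

(** At time [k / 8] every task of class [k] is at most half done, as otherwise it would be early for
    class [k - 1]; then [card_advanced_lt] forbids all [4 ^ (K - k)] of them to be done within a
    further 1/8. *)
Lemma exists_unfinished s k t : k%:R / 8 <= t <= deadline k ->
  (forall k' : nat, (k' < k)%N -> ((deadline k')%:E < first_early s)%E) ->
  exists2 w, cls (s w) = k & work (run s) w t < 2 ^+ k.
Proof.
move=> /andP[kt tk] kf; pose U := [set v | cls (s v) == k]%SET.
have cardU : #|U| = (4 ^ (K - k))%N.
  rewrite -card_cls -[RHS]cardsE -[RHS](card_preimset _ (@perm_inj _ s)).
  by apply: eq_card => v; rewrite !inE.
have [/existsP[w /andP[/eqP wk wt]]|] :=
    boolP [exists w, (cls (s w) == k) && (work (run s) w t < 2 ^+ k)].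
  by exists w.
rewrite negb_exists => /forallP fin.
suff : (#|U| < 4 ^ (K - k))%N by rewrite cardU ltnn.
apply: (card_advanced_lt card_cls (feasible_run s) (e := k%:R / 8) (t := t)).
- by rewrite kt /=; apply: le_trans tk _; rewrite /deadline -natr1; lra.
- move=> u; rewrite inE => /eqP uk.
  (* Class 0 starts from no work at time 0; for [k > 0], half of [2 ^+ k] is the threshold of class
     [k - 1], whose deadline is [k / 8]. *)
  have [k0|k0] := posnP k.
    by rewrite k0 mul0r work0 ?divr_ge0 //; exact: feasible_run.
  have k1K : (k.-1 < K)%N by rewrite (leq_ltn_trans (leq_pred _)).
  have dk : deadline k.-1 = k%:R / 8 by rewrite /deadline prednK.
  have ltk : (k.-1 < k)%N by rewrite prednK.
  rewrite -[in leRHS](prednK k0) exprSr mulfK // -dk; apply/ltW.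
  apply: (@work_lt_before_early _ _ (Ordinal k1K)); rewrite /= ?uk //.
    by rewrite lexx andbT divr_ge0.
  exact: kf.
- move=> u; rewrite inE => uk; have := fin u.
  by rewrite uk /= -leNgt.
Qed.

Lemma exists_no_early : exists s, first_early s = +oo%E.
Proof.
case: (@Order.TotalTheory.arg_maxP _ _ _ 1%g xpredT first_early isT).
move=> s0 _ max0.
pose hits s := #|[pred x | early s x && (reach s x.1 x.2 <= first_early s)%E]|.
have [s /eqP ss0 mins] := @arg_minnP _ s0
  (fun s => first_early s == first_early s0) hits (eqxx _).
exists s; apply/eqP; apply/negPn/negP => fin.
have [[v0 kx] ex rx] : exists2 x, early s x & first_early s = reach s x.1 x.2.
  case: (pickP (early s)) => [y ey|e0]; last first.
    by move: fin; rewrite /first_early big_pred0 ?eqxx.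
  have [|x ex fx] := @eq_bigmin _ _ _ +oo%E y (early s)
    (fun x => reach s x.1 x.2) ey; last by exists x; rewrite // /first_early fx.
  by move=> *; rewrite leey.
have [t1 [/= rt1 /andP[t10 t1d] kxv0 wv0]] := earlyP ex.
have ft1 : first_early s = t1%:E by rewrite rx.
have exk : exists k : nat, t1 <= deadline k by exists kx.
(* [k0] is the class in whose window [t1] lies: its deadline is not yet past, all lower ones are.
   Since [k0 <= kx], task [v0] is of class above [k0]. *)
case: (ex_minnP exk) => k0n t1k0 mink0.
have k0x : (k0n <= kx)%N by exact: mink0.
pose k0 : 'I_K := Ordinal (leq_ltn_trans k0x (ltn_ord kx)).
have before_t1 (k' : nat) : (k' < k0)%N -> deadline k' < t1.
  by move=> k'0; rewrite ltNge; apply/negP => /mink0; rewrite leqNgt k'0.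
have k0v0 : (k0 < cls (s v0))%N := leq_ltn_trans k0x kxv0.
have [||w wk ww] := @exists_unfinished s k0 t1.
- rewrite t1k0 andbT; have [->|k00] := posnP k0; first by rewrite mul0r.
  by rewrite -(prednK k00); apply/ltW/before_t1; rewrite prednK.
- by move=> k' /before_t1; rewrite ft1 lte_fin.
pose s' := (tperm v0 w * s)%g.
have s'v0 : s' v0 = s w by rewrite permM tpermL.
have s'w : s' w = s v0 by rewrite permM tpermR.
have s'D u : u != v0 -> u != w -> s' u = s u.
  by move=> uv uw; rewrite permM tpermD // eq_sym.
have exp_le (a b : nat) : (a <= b)%N -> 2 ^+ a <= 2 ^+ b :> R.
  by move=> ab; rewrite ler_weXn2l ?ler1n.
(* Before [t1] neither [v0] nor [w] has received [2 ^+ k0], while both have at least this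
   requirement under [s] and under [s'], so [online_agree] applies. *)
have agree u t : 0 <= t <= t1 -> work (run s') u t = work (run s) u t.
  move=> /andP[t0 tt1]; symmetry.
  apply: (eq_work (feasible_run s) (feasible_run s')) => y /andP[y0 yt].
  apply: (@online_agree _ _ _ _ _ t1 online); try exact: valid_hard_req.
    move=> z; rewrite /hard_req => dz x /andP[x0 xt1].
    have [zv0|zv0] := eqVneq z v0.
      have wz : work (run s) z x < 2 ^+ k0.
        apply: work_lt_before_early; rewrite ?zv0 ?ft1 ?lte_fin // x0.
        exact: le_trans (ltW xt1) t1k0.
      split; apply: lt_le_trans wz _; apply: exp_le.
        by rewrite zv0 ltnW.
      by rewrite zv0 s'v0 wk.
    have [zw|zw] := eqVneq z w; last by rewrite s'D // eqxx in dz.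
    have wz : work (run s) z x < 2 ^+ k0.
      rewrite zw; apply: le_lt_trans ww.
      by apply: work_le; [exact: feasible_run|exact: ltW].
    split; apply: lt_le_trans wz _; apply: exp_le; first by rewrite zw wk.
    by rewrite zw s'w ltnW.
  by rewrite y0 (lt_le_trans yt).
(* The swap creates no early pair up to [t1]. Task [v0] now has class [k0], so only classes with
   deadlines before [t1] could make it early, and it would have been so under [s]. Task [w] has less
   than [2 ^+ k0], so it can only reach classes below [k0], its own class under [s]. *)
have early' u k : early s' (u, k) -> (reach s' u k <= t1%:E)%E ->
    [/\ u != v0, early s (u, k) & (reach s u k <= reach s' u k)%E].
  move=> /earlyP[t [-> /andP[t0 td] ku wu]]; rewrite lee_fin => tt1.
  rewrite agree ?t0 // in wu.
  have nv0 : (k < cls (s v0))%N -> t < t1 -> u != v0.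
    move=> kv0 ltt1; apply/eqP => uv0; rewrite uv0 in wu.
    have := @work_lt_before_early s v0 k t kv0.
    by rewrite t0 td ft1 lte_fin => /(_ isT ltt1); rewrite ltNge wu.
  have uv0 : u != v0.
    apply/eqP => uv0; rewrite uv0 s'v0 wk in ku.
    have dt1 := before_t1 k ku.
    move: nv0; rewrite uv0 eqxx => /(_ (ltn_trans ku k0v0)).
    by rewrite (le_lt_trans td dt1) => /(_ isT).
  have ku' : (k < cls (s u))%N.
    have [uw|uw] := eqVneq u w; last by rewrite -s'D.
    rewrite uw wk ltnNge; apply/negP => k0k.
    have := le_lt_trans (le_trans (exp_le _ _ k0k) wu).
    rewrite uw => /(_ _ (le_lt_trans (work_le (feasible_run s) w tt1) ww)).
    by rewrite ltxx.
  by have [] := earlyI ku' _ wu; rewrite ?t0 ?td.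
have le_first : (t1%:E <= first_early s')%E.
  apply/bigmin_geP; split; first by rewrite leey.
  move=> [u k] es' /=; rewrite leNgt; apply/negP => lt1.
  have [_ es rle] := early' u k es' (ltW lt1).
  have := first_early_le es; rewrite ft1 /= leNgt => /negP; apply.
  exact: le_lt_trans rle lt1.
have fs' : first_early s' = t1%:E.
  by apply/le_anti; rewrite le_first andbT -ft1 ss0; exact: max0.
have := mins s'; rewrite fs' -ft1 ss0 eqxx => /(_ isT).
(* The pairs counted by [hits s'] are among those of [hits s], and [(v0, kx)] is lost, against the
   minimality of [hits s]. *)
apply/negP; rewrite -ltnNge; apply: proper_card; apply/properP; split.
  apply/fintype.subsetP => -[u k]; rewrite !inE /= fs' ft1 => /andP[es' rs'].
  have [_ es rle] := early' u k es' rs'.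
  by rewrite es (le_trans rle).
exists (v0, kx); rewrite !inE /=; first by rewrite ex rx lexx.
apply/negP => /andP[es']; rewrite fs' => rs'.
by have [/eqP] := early' _ _ es' rs'.
Qed.

End Adversary.

(** * The lower bound with constant 1/8 *)

Theorem theorem1 (R : realType) :
  exists c : R, 0 < c /\
    forall K : nat, (1 <= K)%N ->
    forall A : algorithm R, online_nonclairvoyant A ->
      ((c * K%:R)%:E <= competitive_ratio A K)%E.
Proof.
exists 8^-1; split; first by rewrite invr_gt0.
move=> K K1 A online.
have [n [cls card_cls]] := @exists_class_map K (fun k => 4 ^ (K - k))%N.
have [s s_oo] := exists_no_early card_cls online.
have lastK : (K.-1 < K)%N by rewrite prednK.
have KE : K%:R = K.-1.+1%:R :> R by rewrite prednK.
(* [K / 8] is the deadline of the top class [K - 1], and with no early pair the premise on lower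
   classes is immediate. *)
have [||w wk ww] := @exists_unfinished R K n cls card_cls A online s
  (Ordinal lastK) (K%:R / 8).
- by rewrite /deadline /= -KE lexx andbT ler_pM2r ?invr_gt0 // ler_nat leq_pred.
- by move=> k' _; rewrite s_oo ltey.
have n0 : (0 < n)%N by exact: leq_ltn_trans (ltn_ord w).
pose p := hard_req R cls s.
have cost_ge : ((8^-1 * K%:R)%:E <= cost p (A _ p))%E.
  rewrite hard_cost.
  apply: (@le_trans _ _ (finish_time p (A _ p) w)); last first.
    by rewrite (bigD1 w) //= le_max lexx.
  rewrite leNgt; apply/negP => /ltW.
  have K8 : 0 <= 8^-1 * K%:R :> R by rewrite mulr_ge0.
  move=> /(finish_time_leP (feasible_run cls online s) _ _ K8).
  by rewrite mulrC leNgt /p /hard_req wk ww.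
have exp2_inj : injective (GRing.exp (2 : R)).
  by apply: ieexprIn; rewrite ?pnatr_eq1.
have o0 : (0 < opt p)%E by exact: opt_hard_gt0.
have o1 : (opt p <= 1)%E by exact: opt_hard_le1.
apply: (@le_trans _ _ (cost p (A _ p) / opt p)%E); last first.
  apply: ereal_sup_ubound; exists (hard_env R cls), p; split=> //.
    (* All [K] powers of 2 occur as speeds because every class is nonempty, and they are
       distinct. *)
    transitivity (size [seq (2 ^+ val k : R) | k : 'I_K <- enum 'I_K]);
      last first.
      by rewrite size_map size_enum_ord.
    rewrite /nspeeds; apply: perm_size; apply: uniq_perm.
      exact: undup_uniq.
      rewrite map_inj_uniq ?enum_uniq //.
      by move=> k k' /exp2_inj/val_inj.
    move=> x; rewrite mem_undup; apply/codomP/mapP => [[i ->]|[k _ ->]].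
      by exists (cls i); rewrite ?mem_enum.
    have : (0 < #|[pred i | cls i == k]|)%N by rewrite card_cls expn_gt0.
    by move=> /card_gt0P[i]; rewrite inE => /eqP <-; exists i.
  exact: valid_hard_req.
apply: (le_trans cost_ge).
have [r orr] : exists r, opt p = r%:E.
  by move: o0 o1; case: (opt p) => // r _ _; exists r.
move: o0 o1; rewrite orr lte_fin lee_fin => r0 r1.
rewrite inver gt_eqF // -[leLHS]mule1; apply: lee_pmul => //.
  by apply: le_trans cost_ge; rewrite lee_fin mulr_ge0.
by rewrite lee_fin invf_ge1.
Qed.
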